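(* Suppose that we have a $k$-th order system of two rational difference equations $$x_n=\frac{\alpha+\sum^{k}_{i=1}\beta_{i}x_{n-i} + \sum^{k}_{i=1}\gamma_{i}y_{n-i}}{A+\sum^{k}_{j=1}B_{j}x_{n-j} + \sum^{k}_{j=1}C_{j}y_{n-j}},\qquad y_n=\frac{p+\sum^{k}_{i=1}\delta_{i}x_{n-i} + \sum^{k}_{i=1}\epsilon_{i}y_{n-i}}{q+\sum^{k}_{j=1}D_{j}x_{n-j} + \sum^{k}_{j=1}E_{j}y_{n-j}},\qquad n\in\mathbb{N},$$ with non-negative parameters and non-negative initial conditions. Further assume that there exist constants $M_1,M_2>0$ so that $M_1y_n\le x_n\le M_2y_n$ for all $n\in\mathbb{N}$. Also suppose that $A=0$ and one of the following holds: (i) $I_B\cup I_C\subseteq I_\beta\cup I_\gamma$ and $I_B\neq\emptyset$; (ii) $q=0$, $I_D\cup I_E\subseteq I_\delta\cup I_\epsilon$, and $I_C\neq\emptyset$; (iii) $p,q>0$, $I_D\cup I_E\subseteq I_\delta\cup I_\epsilon$, and $I_C\neq\emptyset$; and that there exists a positive integer $\eta$ such that for every sequence $\{c_m\}_{m=1}^\infty$ with $c_m\in I_\beta\cup I_\gamma$ for $m=1,2,\dots$ there exist positive integers $N_1,N_2\le\eta$ such that $\sum_{m=N_1}^{N_2}c_m\in I_B\cup I_C$. Then there exist $M>0$ and $N\in\mathbb{N}$ so that, given any non-negative initial conditions, we have $x_n,y_n\le M$ for all $n>N$.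
   Context: $\mathbb{N}=\{1,2,\dots\}$ and $k$ is a positive integer. Initial conditions are $x_{1-k},\dots,x_0,y_{1-k},\dots,y_0\ge 0$, taken so that the denominators do not vanish. For each family of coefficients, the index set is the set of indices in $\{1,\dots,k\}$ with positive coefficient: $I_\beta=\{i:\beta_i>0\}$, $I_\gamma=\{i:\gamma_i>0\}$, $I_\delta=\{i:\delta_i>0\}$, $I_\epsilon=\{i:\epsilon_i>0\}$, $I_B=\{j:B_j>0\}$, $I_C=\{j:C_j>0\}$, $I_D=\{j:D_j>0\}$, $I_E=\{j:E_j>0\}$. *)

(* Defs.v *)
From mathcomp Require Import all_boot all_order all_algebra.
From mathcomp Require Import classical_sets reals.

Set Implicit Arguments.
Unset Strict Implicit.
Unset Printing Implicit Defensive.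

Import Order.TTheory GRing.Theory Num.Theory.

Local Open Scope classical_set_scope.
Local Open Scope ring_scope.

(* Families of coefficients are functions on nat of which only the values at
   1, ..., k are ever used; sequences are functions on int of which only the
   values at integers >= 1 - k are ever used. *)

Definition index_set (R : realType) (k : nat) (a : nat -> R) : set nat :=
  [set i | (1 <= i <= k)%N /\ 0 < a i].

Definition nonneg_coeffs (R : realType) (k : nat) (a : nat -> R) : Prop :=
  forall i : nat, (1 <= i <= k)%N -> 0 <= a i.

Definition affine_form (R : realType) (k : nat) (c : R) (a b : nat -> R)
    (x y : int -> R) (n : int) : R :=
  c + \sum_(1 <= i < k.+1) a i * x (n - i%:Z)
    + \sum_(1 <= i < k.+1) b i * y (n - i%:Z).

(* The initial conditions are the values at 0, -1, ..., 1 - k. Division by zero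
   is total in MathComp, so the nonvanishing of the denominators along the
   whole solution, which is a restriction on the initial conditions, is
   required explicitly. *)
Definition is_solution (R : realType) (k : nat)
    (alpha : R) (beta gamma : nat -> R) (A : R) (B C : nat -> R)
    (p : R) (delta epsilon : nat -> R) (q : R) (D E : nat -> R)
    (x y : int -> R) : Prop :=
  (forall j : nat, (j < k)%N -> 0 <= x (- j%:Z) /\ 0 <= y (- j%:Z)) /\
  (forall n : nat, (1 <= n)%N ->
    [/\ affine_form k A B C x y n%:Z != 0,
        affine_form k q D E x y n%:Z != 0,
        x n%:Z = affine_form k alpha beta gamma x y n%:Z
                   / affine_form k A B C x y n%:Z
      & y n%:Z = affine_form k p delta epsilon x y n%:Z
                   / affine_form k q D E x y n%:Z]).

(* Main.v *)
Require Import Defs.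
From mathcomp Require Import all_boot all_order all_algebra.
From mathcomp Require Import boolp classical_sets reals.
From mathcomp Require Import zify.

Import Order.TTheory GRing.Theory Num.Theory.

Local Open Scope classical_set_scope.
Local Open Scope ring_scope.

(** Comparability of [x] and [y] turns the first equation into
    [x_n ~ (alpha + sum_S x_(n-i)) / sum_T x_(n-j)] up to constants, where
    [S = I_beta `|` I_gamma] and [T = I_B `|` I_C]. Each of the three cases
    bounds [x_n] below by a constant [L > 0] for [n > k], because one of the two
    numerators dominates its denominator. Letting [c] be the index in [S] with
    [x_(n-c)] largest, this gives [x_n x_(n-j) <= H x_(n-c)] for all [j] in [T],
    hence also [x_n <= rho x_(n-c)]. Follow these maximizers backwards, [n_0 = n]
    and [n_m = n_(m-1) - c_m]. The hypothesis on [eta] provides [N1, N2 <= eta]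
    with [n_(N1-1) - n_(N2)] in [T], so that
    [x_(n_(N1-1)) x_(n_(N2)) <= H x_(n_(N1)) <= H rho^eta x_(n_(N2))]. Cancelling
    bounds [x_(n_(N1-1))], and then [x_n <= rho^eta x_(n_(N1-1))]. *)

(** * Domination of coefficients and maximizing indices *)

Lemma ler_sum_term {R : numDomainType} {k i : nat} (a : nat -> R) :
  (forall j, (1 <= j <= k)%N -> 0 <= a j) -> (1 <= i <= k)%N ->
  a i <= \sum_(1 <= j < k.+1) a j.
Proof.
move=> a_ge0 ik.
rewrite (bigD1_seq i) ?mem_index_iota ?iota_uniq //=.
rewrite lerDl big_seq_cond sumr_ge0 // => j /andP[+ _].
by rewrite mem_index_iota => jk; apply: a_ge0; lia.
Qed.

(** Where [b i] is positive so is [a i], hence [b i / a i] is a genuine ratio, and the sum of all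
    ratios bounds each one. The added [1] keeps the factor positive. *)
Lemma coeffs_dominated {R : realType} {k : nat} {a b : nat -> R} :
  nonneg_coeffs k a -> nonneg_coeffs k b ->
  index_set k b `<=` index_set k a ->
  exists2 r : R, 0 < r & forall i, (1 <= i <= k)%N -> b i <= r * a i.
Proof.
move=> a_ge0 b_ge0 sub_ba.
have ratio_ge0 j : (1 <= j <= k)%N -> 0 <= b j / a j.
  by move=> jk; rewrite divr_ge0 ?a_ge0 ?b_ge0.
exists (1 + \sum_(1 <= j < k.+1) b j / a j).
  by rewrite ltr_pwDl // big_nat sumr_ge0.
move=> i ik; have := b_ge0 i ik; rewrite le_eqVlt => /orP[/eqP <-|b_gt0].
  by rewrite mulr_ge0 ?a_ge0 // addr_ge0 // big_nat sumr_ge0.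
have [_ ai_gt0] : index_set k a i by apply: sub_ba.
by rewrite -ler_pdivrMr // (le_trans (ler_sum_term _ ratio_ge0 ik)) // lerDr.
Qed.

Lemma exists_argmax {R : realType} {k : nat} {S : set nat} {u : nat -> R} :
  (forall i, S i -> (i <= k)%N) -> S !=set0 ->
  exists2 c, S c & forall i, S i -> u i <= u c.
Proof.
move=> S_le [i0 Si0].
have i0k := S_le _ Si0; rewrite -ltnS in i0k.
case: (@Order.TotalTheory.arg_maxP _ R _ (Ordinal i0k)
  (fun i : 'I_k.+1 => `[< S i >]) (fun i : 'I_k.+1 => u i)).
  exact/asboolP.
move=> c /asboolP Sc c_max; exists (c : nat) => // i Si.
have ik := S_le _ Si; rewrite -ltnS in ik.
by apply: (c_max (Ordinal ik)); apply/asboolP.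
Qed.

(** * The boundedness argument for a single sequence *)

(** [M] is chosen before [z], which later makes the bound independent of the initial conditions.
    Truncation in [n - j] does no harm, since the recurrence is used only for [k <= n]. *)
Lemma eventually_bounded {R : realType} {k eta : nat} {a L : R}
    {s b : nat -> R} :
  0 <= a -> 0 < L -> nonneg_coeffs k s -> nonneg_coeffs k b ->
  index_set k b !=set0 ->
  (forall c : nat -> nat,
    (forall m, (1 <= m)%N -> index_set k s (c m)) ->
    exists N1 N2, [/\ (1 <= N1 <= eta)%N, (1 <= N2 <= eta)%N &
      index_set k b (\sum_(N1 <= m < N2.+1) c m)%N]) ->
  exists M : R, forall z : nat -> R,
    (forall n, L <= z n) ->
    (forall n, (k <= n)%N ->
      z n * (\sum_(1 <= j < k.+1) b j * z (n - j)%N)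
        <= a + \sum_(1 <= i < k.+1) s i * z (n - i)%N) ->
    forall n, (eta.+1 * k <= n)%N -> z n <= M.
Proof.
move=> a_ge0 L_gt0 s_ge0 b_ge0 [j0 Tj0] chain.
have b_inv_ge0 j : (1 <= j <= k)%N -> 0 <= (b j)^-1.
  by move=> jk; rewrite invr_ge0 b_ge0.
(* One constant above every [(b j)^-1] with [1 <= j <= k]; zero coefficients contribute [0]. *)
pose binv : R := \sum_(1 <= j < k.+1) (b j)^-1.
have binv_ge0 : 0 <= binv by rewrite /binv big_nat sumr_ge0.
pose stot : R := \sum_(1 <= i < k.+1) s i.
have stot_ge0 : 0 <= stot by rewrite /stot big_nat sumr_ge0.
have prod_le z n j r : (forall m, L <= z m) -> index_set k b j ->
    z n * (\sum_(1 <= j < k.+1) b j * z (n - j)%N) <= r ->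
    z n * z (n - j)%N <= r * binv.
  move=> z_ge [jk bj_gt0] le_r.
  have z_gt0 m : 0 < z m by apply: lt_le_trans (z_ge m).
  have le1 : z n * (b j * z (n - j)%N) <= r.
    apply: le_trans le_r; rewrite ler_pM2l //.
    apply: (ler_sum_term (fun j => b j * z (n - j)%N)) => // i ik.
    by rewrite mulr_ge0 ?b_ge0 // ltW.
  have r_ge0 : 0 <= r by apply: le_trans le1; rewrite !mulr_ge0 // ltW.
  apply: (@le_trans _ _ (r * (b j)^-1)).
    by rewrite ler_pdivlMr // -mulrA (mulrC _ (b j)).
  by apply: ler_wpM2l => //; apply: (ler_sum_term (fun j => (b j)^-1)).
(* Without positive [s i] there is no maximizer to follow, but then the right-hand side is just [a],
   and [z (n - j0) >= L] bounds [z n] at once. *)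
have [S0|/set0P S_neq0] := eqVneq (index_set k s) set0.
  exists (a * binv / L) => z z_ge z_rec n n_ge.
  have nk : (k <= n)%N by nia.
  have sum0 : \sum_(1 <= i < k.+1) s i * z (n - i)%N = 0.
    rewrite big_nat big1 // => i ik; have : ~ index_set k s i by rewrite S0.
    have := s_ge0 i ik; rewrite le_eqVlt => /orP[/eqP <-|si_gt0 []//].
    by rewrite mul0r.
  have := z_rec n nk; rewrite sum0 addr0.
  move=> /(prod_le _ _ _ _ z_ge Tj0) le_a.
  rewrite ler_pdivlMr //; apply: le_trans le_a.
  by rewrite ler_wpM2l // (le_trans (ltW L_gt0)).
(* The constant term is absorbed by [a <= (a / L) * z (m - c)]; maximality of [c] bounds the sum by
   [stot * z (m - c)]. *)
pose H := (a / L + stot) * binv.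
have H_ge0 : 0 <= H by rewrite mulr_ge0 // addr_ge0 // divr_ge0 // ltW.
(* The summand [1] gives [1 <= rho], so powers with exponent at most [eta] are bounded by
   [rho ^+ eta]. *)
pose rho := 1 + H / L.
have rho_ge1 : 1 <= rho by rewrite lerDl divr_ge0 // ltW.
have rho_ge0 : 0 <= rho by apply: le_trans rho_ge1.
exists (rho ^+ eta * (H * rho ^+ eta)) => z z_ge z_rec n n_ge.
have z_gt0 m : 0 < z m by apply: lt_le_trans (z_ge m).
have /choice[f fP] m : exists c, index_set k s c /\
    forall i, index_set k s i -> z (m - i)%N <= z (m - c)%N.
  have S_le i : index_set k s i -> (i <= k)%N by move=> [] /andP[].
  have [c Sc c_max] := exists_argmax (u := fun i => z (m - i)%N) S_le S_neq0.
  by exists c.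
have prod_step m j : (k <= m)%N -> index_set k b j ->
    z m * z (m - j)%N <= H * z (m - f m)%N.
  move=> mk Tj; rewrite /H mulrAC; apply: prod_le => //.
  apply: le_trans (z_rec m mk) _; rewrite mulrDl lerD //.
    by rewrite -mulrA ler_peMr // mulrC ler_pdivlMr // mul1r.
  rewrite /stot mulr_suml big_nat [leRHS]big_nat; apply: ler_sum => i ik.
  have := s_ge0 i ik; rewrite le_eqVlt => /orP[/eqP <-|si_gt0].
    by rewrite !mul0r.
  by rewrite ler_pM2l //; apply: (fP m).2.
have step m : (k <= m)%N -> z m <= rho * z (m - f m)%N.
  move=> mk; apply: (@le_trans _ _ (H / L * z (m - f m)%N)).
    rewrite mulrAC ler_pdivlMr //; apply: le_trans (prod_step m _ mk Tj0).
    by rewrite ler_pM2l.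
  by rewrite ler_pM2r // lerDr.
(* Each backward step loses at most [k], so from [n >= eta.+1 * k] the first [eta] steps stay at
   times [>= k], where the recurrence applies. *)
pose t m := iter m (fun m => m - f m)%N n.
have f_le m : (1 <= f m <= k)%N by have [[]] := fP m.
have t_ge m : (m <= eta)%N -> (k * (eta.+1 - m) <= t m)%N.
  elim: m => [|m IH] m_le; first by rewrite subn0 mulnC.
  have := IH (ltnW m_le); have := f_le (t m); rewrite /t iterS -/(t m).
  have -> : (eta.+1 - m = (eta.+1 - m.+1).+1)%N by lia.
  by rewrite mulnS; lia.
have t_gek m : (m <= eta)%N -> (k <= t m)%N.
  by move=> m_le; apply: leq_trans (t_ge m m_le); rewrite leq_pmulr //; lia.
have iter_step m d : (m + d <= eta)%N -> z (t m) <= rho ^+ d * z (t (m + d)%N).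
  elim: d => [|d IH] md; first by rewrite expr0 mul1r addn0.
  apply: le_trans (IH _) _; first by lia.
  rewrite exprSr -mulrA ler_wpM2l ?exprn_ge0 // addnS.
  by apply: step; apply: t_gek; lia.
have t_sum m d : (m + d <= eta)%N ->
    (t m = t (m + d) + \sum_(m.+1 <= i < (m + d).+1) f (t i.-1))%N.
  elim: d => [|d IH] md; first by rewrite addn0 big_geq // addn0.
  rewrite addnS big_nat_recr /=; last by lia.
  rewrite IH; last by lia.
  have := t_gek (m + d)%N; have := f_le (t (m + d)%N).
  by rewrite /t /= -/(t _); lia.
have [m _|N1 [N2 [/andP[N1_gt0 N1_le] /andP[_ N2_le] TN]]] :=
  chain (fun m => f (t m.-1)).
  exact: (fP _).1.
case: N1 => // N in N1_gt0 N1_le TN.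
(* Otherwise the sum is empty, and [0] is not an admissible index. *)
have N_lt : (N < N2)%N.
  rewrite ltnNge; apply/negP => N2N; case: TN; rewrite big_geq //; lia.
have bound_N : z (t N) <= H * rho ^+ eta.
  have := prod_step (t N) _ (t_gek N (ltnW N1_le)) TN.
  have := t_sum N (N2 - N)%N; rewrite subnKC; last exact: ltnW.
  (* The index supplied by [chain] is [t N - t N2], so [prod_step] pairs [z (t N)] with [z (t N2)],
     which is then cancelled. *)
  move=> /(_ N2_le) tN; rewrite {2}tN addnK -/(t N.+1) => le_H.
  rewrite -(ler_pM2r (z_gt0 (t N2))); apply: le_trans le_H _.
  rewrite -[leRHS]mulrA ler_wpM2l //.
  have := iter_step N.+1 (N2 - N.+1)%N; rewrite subnKC // => /(_ N2_le) le_rho.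
  apply: le_trans le_rho _; rewrite ler_pM2r // ler_weXn2l //; lia.
have := iter_step 0%N N; rewrite add0n => /(_ (ltnW N1_le)) /le_trans; apply.
by rewrite ler_pM ?exprn_ge0 ?(ltW (z_gt0 _)) // ler_weXn2l // ltnW.
Qed.

(** * Affine forms in comparable sequences *)

Section AffineForm.
Context {R : realType} {k : nat}.
Implicit Types (a b : nat -> R) (c : R) (x y : int -> R) (n : int).

Lemma affine_form_ge0 c a b x y n :
  0 <= c -> nonneg_coeffs k a -> nonneg_coeffs k b ->
  (forall i, (1 <= i <= k)%N -> 0 <= x (n - i%:Z) /\ 0 <= y (n - i%:Z)) ->
  0 <= affine_form k c a b x y n.
Proof.
move=> c_ge0 a_ge0 b_ge0 xy_ge0; rewrite /affine_form !addr_ge0 //;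
by rewrite big_nat sumr_ge0 // => i ik; have [? ?] := xy_ge0 i ik;
  rewrite mulr_ge0 ?a_ge0 ?b_ge0.
Qed.

(** Lowering [y] to [m * x], and [x] to [m * x] by [m <= 1], merges both families into one sum in
    [x]. *)
Lemma affine_form_ge c a b x y n (m : R) :
  m <= 1 -> nonneg_coeffs k a -> nonneg_coeffs k b ->
  (forall i, (1 <= i <= k)%N ->
    0 <= x (n - i%:Z) /\ m * x (n - i%:Z) <= y (n - i%:Z)) ->
  c + \sum_(1 <= i < k.+1) m * (a i + b i) * x (n - i%:Z)
    <= affine_form k c a b x y n.
Proof.
move=> m_le1 a_ge0 b_ge0 xy; rewrite /affine_form -addrA lerD2l -big_split /=.
rewrite big_nat [leRHS]big_nat; apply: ler_sum => i ik.
have [x_ge0 xy_le] := xy i ik; rewrite mulrDr mulrDl lerD //.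
  by rewrite mulrAC mulrC ler_wpM2l ?a_ge0 // ler_piMl.
by rewrite mulrAC mulrC ler_wpM2l ?b_ge0.
Qed.

Lemma affine_form_le c a b x y n (m : R) :
  1 <= m -> nonneg_coeffs k a -> nonneg_coeffs k b ->
  (forall i, (1 <= i <= k)%N ->
    0 <= x (n - i%:Z) /\ y (n - i%:Z) <= m * x (n - i%:Z)) ->
  affine_form k c a b x y n
    <= c + \sum_(1 <= i < k.+1) m * (a i + b i) * x (n - i%:Z).
Proof.
move=> m_ge1 a_ge0 b_ge0 xy; rewrite /affine_form -addrA lerD2l -big_split /=.
rewrite big_nat [leRHS]big_nat; apply: ler_sum => i ik.
have [x_ge0 xy_le] := xy i ik; rewrite mulrDr mulrDl lerD //.
  by rewrite mulrAC [leRHS]mulrC ler_wpM2l ?a_ge0 // ler_peMl.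
by rewrite mulrAC [leRHS]mulrC ler_wpM2l ?b_ge0.
Qed.

Lemma index_set_scaleD (m : R) a b :
  0 < m -> nonneg_coeffs k a -> nonneg_coeffs k b ->
  index_set k (fun i => m * (a i + b i)) = index_set k a `|` index_set k b.
Proof.
move=> m_gt0 a_ge0 b_ge0; apply/seteqP; split=> i.
  move=> [ik]; rewrite pmulr_rgt0 // => ab_gt0.
  have := a_ge0 i ik; rewrite le_eqVlt => /orP[/eqP a0|]; last by left.
  by rewrite -a0 add0r in ab_gt0; right.
case=> -[ik gt0]; split=> //; rewrite pmulr_rgt0 //.
  by rewrite ltr_pwDl ?b_ge0.
by rewrite ltr_wpDl ?a_ge0.
Qed.

Lemma nonneg_coeffs_scaleD (m : R) a b :
  0 <= m -> nonneg_coeffs k a -> nonneg_coeffs k b ->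
  nonneg_coeffs k (fun i => m * (a i + b i)).
Proof.
by move=> m_ge0 a_ge0 b_ge0 i ik; rewrite mulr_ge0 // addr_ge0 ?a_ge0 ?b_ge0.
Qed.

(** After merging, [r] controls the ratio of the coefficients and [c1 / c0] that of the constants,
    so [r + c1 / c0] bounds denominator over numerator. If [c0 = 0] then [c1 = 0] as well. *)
Lemma affine_quotient_ge (m M c0 c1 : R) a0 b0 a1 b1 :
  0 < m <= 1 -> 1 <= M -> 0 <= c0 -> 0 <= c1 -> (0 < c1 -> 0 < c0) ->
  nonneg_coeffs k a0 -> nonneg_coeffs k b0 ->
  nonneg_coeffs k a1 -> nonneg_coeffs k b1 ->
  index_set k a1 `|` index_set k b1 `<=` index_set k a0 `|` index_set k b0 ->
  exists2 L : R, 0 < L & forall x y n,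
    (forall i, (1 <= i <= k)%N -> 0 <= x (n - i%:Z) /\
      m * x (n - i%:Z) <= y (n - i%:Z) <= M * x (n - i%:Z)) ->
    0 < affine_form k c1 a1 b1 x y n ->
    L <= affine_form k c0 a0 b0 x y n / affine_form k c1 a1 b1 x y n.
Proof.
move=> /andP[m_gt0 m_le1] M_ge1 c0_ge0 c1_ge0 c10 a0_ge0 b0_ge0 a1_ge0 b1_ge0 sub.
have M_gt0 : 0 < M by apply: lt_le_trans M_ge1.
have s0_ge0 := nonneg_coeffs_scaleD _ _ _ (ltW m_gt0) a0_ge0 b0_ge0.
have s1_ge0 := nonneg_coeffs_scaleD _ _ _ (ltW M_gt0) a1_ge0 b1_ge0.
have [|r r_gt0 r_dom] := coeffs_dominated s0_ge0 s1_ge0.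
  by rewrite !index_set_scaleD.
have q_ge0 : 0 <= c1 / c0 by rewrite divr_ge0.
have rq_gt0 : 0 < r + c1 / c0 by rewrite ltr_pwDl.
exists (r + c1 / c0)^-1; first by rewrite invr_gt0.
move=> x y n xy den_gt0; rewrite ler_pdivlMr // mulrC ler_pdivrMr // mulrC.
apply: le_trans (affine_form_le _ _ _ _ _ _ _ M_ge1 a1_ge0 b1_ge0 _) _.
  by move=> i /xy[? /andP[]].
apply: (@le_trans _ _ ((r + c1 / c0) *
    (c0 + \sum_(1 <= i < k.+1) m * (a0 i + b0 i) * x (n - i%:Z)))); last first.
  rewrite ler_pM2l //; apply: affine_form_ge => // i /xy[? /andP[]] //.
rewrite mulrDr lerD //.
  move: c1_ge0; rewrite le_eqVlt => /orP[/eqP <-|/[dup] c1_gt0 /c10 c0_gt0].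
    by rewrite mul0r addr0 mulr_ge0 // ltW.
  by rewrite mulrDl divfK ?gt_eqF // lerDr mulr_ge0 // ltW.
rewrite mulr_sumr big_nat [leRHS]big_nat; apply: ler_sum => i ik.
rewrite mulrA ler_wpM2r ?(xy i ik).1 //.
apply: le_trans (r_dom i ik) _.
by rewrite ler_wpM2r ?s0_ge0 // lerDl.
Qed.

End AffineForm.

(** * Solutions of the system: nonnegativity and boundedness *)

(** Strong induction on time: each index [n - i] is either an earlier natural number or that of an
    initial condition. *)
Lemma solution_ge0 {R : realType} {k : nat} {alpha : R} {beta gamma : nat -> R}
    {A : R} {B C : nat -> R} {p : R} {delta epsilon : nat -> R} {q : R}
    {D E : nat -> R} {x y : int -> R} :
  0 <= alpha -> 0 <= A -> 0 <= p -> 0 <= q ->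
  nonneg_coeffs k beta -> nonneg_coeffs k gamma ->
  nonneg_coeffs k B -> nonneg_coeffs k C ->
  nonneg_coeffs k delta -> nonneg_coeffs k epsilon ->
  nonneg_coeffs k D -> nonneg_coeffs k E ->
  is_solution k alpha beta gamma A B C p delta epsilon q D E x y ->
  forall n : int, - k%:Z < n -> 0 <= x n /\ 0 <= y n.
Proof.
move=> ? ? ? ? ? ? ? ? ? ? ? ? [init rec].
have nat_ge0 (n : nat) : - k%:Z < n%:Z -> 0 <= x n%:Z /\ 0 <= y n%:Z.
  elim/ltn_ind: n => -[|n] IH n_gt; first by apply: (init 0%N); lia.
  have prev_ge0 i : (1 <= i <= k)%N ->
      0 <= x (n.+1%:Z - i%:Z) /\ 0 <= y (n.+1%:Z - i%:Z).
    move=> ik; have [i_le|i_gt] := leqP i n.+1.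
      have -> : n.+1%:Z - i%:Z = (n.+1 - i)%N%:Z by lia.
      by apply: IH; lia.
    have -> : n.+1%:Z - i%:Z = - (i - n.+1)%N%:Z by lia.
    by apply: init; lia.
  have [_ _ -> ->] := rec n.+1 isT.
  by split; rewrite divr_ge0 ?affine_form_ge0.
case=> n n_gt; first exact: nat_ge0.
by rewrite NegzE; apply: init; lia.
Qed.

Theorem theorem3 (R : realType) (k : nat)
    (alpha : R) (beta gamma : nat -> R) (A : R) (B C : nat -> R)
    (p : R) (delta epsilon : nat -> R) (q : R) (D E : nat -> R)
    (k_gt0 : (0 < k)%N)
    (alpha_ge0 : 0 <= alpha) (A_ge0 : 0 <= A) (p_ge0 : 0 <= p) (q_ge0 : 0 <= q)
    (beta_ge0 : nonneg_coeffs k beta) (gamma_ge0 : nonneg_coeffs k gamma)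
    (B_ge0 : nonneg_coeffs k B) (C_ge0 : nonneg_coeffs k C)
    (delta_ge0 : nonneg_coeffs k delta)
    (epsilon_ge0 : nonneg_coeffs k epsilon)
    (D_ge0 : nonneg_coeffs k D) (E_ge0 : nonneg_coeffs k E)
    (comparable_xy : exists M1 M2 : R, [/\ 0 < M1, 0 < M2 &
      forall x y : int -> R,
        is_solution k alpha beta gamma A B C p delta epsilon q D E x y ->
        forall n : nat, (1 <= n)%N ->
          M1 * y n%:Z <= x n%:Z /\ x n%:Z <= M2 * y n%:Z])
    (A_eq0 : A = 0)
    (cases :
      [\/ index_set k B `|` index_set k C
            `<=` index_set k beta `|` index_set k gamma
          /\ index_set k B !=set0,
          [/\ q = 0,
              index_set k D `|` index_set k E
                `<=` index_set k delta `|` index_set k epsilon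
            & index_set k C !=set0]
        | [/\ 0 < p, 0 < q,
              index_set k D `|` index_set k E
                `<=` index_set k delta `|` index_set k epsilon
            & index_set k C !=set0]])
    (eta_cond : exists2 eta : nat, (1 <= eta)%N &
      forall c : nat -> nat,
        (forall m : nat, (1 <= m)%N ->
          (index_set k beta `|` index_set k gamma) (c m)) ->
        exists N1 N2 : nat,
          [/\ (1 <= N1 <= eta)%N, (1 <= N2 <= eta)%N &
              (index_set k B `|` index_set k C)
                (\sum_(N1 <= m < N2.+1) c m)%N]) :
  exists (M : R) (N : nat), [/\ 0 < M, (1 <= N)%N &
    forall x y : int -> R,
      is_solution k alpha beta gamma A B C p delta epsilon q D E x y ->
      forall n : nat, (N < n)%N -> x n%:Z <= M /\ y n%:Z <= M].
Proof.
case: comparable_xy => M1 [M2 [M1_gt0 M2_gt0 comparable]].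
case: eta_cond => eta eta_ge1 chain.
(* Chosen so that [m <= 1 <= M] while [m * x <= y <= M * x] still follows from comparability and
   nonnegativity. *)
pose m : R := (1 + M2)^-1; pose M : R := 1 + M1^-1.
have M2'_gt0 : 0 < 1 + M2 by rewrite ltr_wpDl.
have m_gt0 : 0 < m by rewrite invr_gt0.
have m_le1 : m <= 1 by rewrite invf_le1 // lerDl ltW.
have M_ge1 : 1 <= M by rewrite lerDl invr_ge0 ltW.
have M_gt0 : 0 < M by apply: lt_le_trans M_ge1.
have compare x y :
    is_solution k alpha beta gamma A B C p delta epsilon q D E x y ->
    forall n : int, 0 < n -> 0 <= x n /\ m * x n <= y n <= M * x n.
  move=> sol [] // n n_gt0.
  have [//|x_ge0 y_ge0] := solution_ge0 alpha_ge0 A_ge0 p_ge0 q_ge0 beta_ge0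
    gamma_ge0 B_ge0 C_ge0 delta_ge0 epsilon_ge0 D_ge0 E_ge0 sol n%:Z.
    by clear -n_gt0; lia.
  have [le_x x_le] := comparable x y sol n n_gt0; split=> //; apply/andP; split.
    by rewrite mulrC ler_pdivrMr // mulrDr mulr1 mulrC -[leLHS]add0r lerD.
  rewrite mulrDl mul1r -[leLHS]add0r lerD // mulrC ler_pdivlMr // mulrC.
  exact: le_x.
(* Comparability is assumed only at positive times, so [k < n] is required to cover all [k]
   predecessors. *)
have compare_prev x y n i :
    is_solution k alpha beta gamma A B C p delta epsilon q D E x y ->
    (k < n)%N -> (1 <= i <= k)%N -> 0 <= x (n%:Z - i%:Z) /\
      m * x (n%:Z - i%:Z) <= y (n%:Z - i%:Z) <= M * x (n%:Z - i%:Z).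
  by move=> sol nk ik; apply: (compare _ _ sol); clear -nk ik; lia.
have form_ge0 c a b x y n :
    is_solution k alpha beta gamma A B C p delta epsilon q D E x y ->
    (k < n)%N -> 0 <= c -> nonneg_coeffs k a -> nonneg_coeffs k b ->
    0 <= affine_form k c a b x y n%:Z.
  move=> sol nk c_ge0 a_ge0 b_ge0; apply: affine_form_ge0 => // i ik.
  have [x_ge0 /andP[le_y _]] := compare_prev x y n i sol nk ik.
  by split=> //; apply: le_trans le_y; rewrite mulr_ge0 // ltW.
have m01 : 0 < m <= 1 by rewrite m_gt0.
have [L L_gt0 x_geL] : exists2 L : R, 0 < L & forall x y,
    is_solution k alpha beta gamma A B C p delta epsilon q D E x y ->
    forall n : nat, (k < n)%N -> L <= x n%:Z.
  (* Cases (ii) and (iii): the quotient for [y] is bounded below, and [M1 * y <= x] transfers the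
     bound. With [q = 0] the condition on the constants is vacuous. *)
  have lower_y : (0 < q -> 0 < p) -> index_set k D `|` index_set k E
        `<=` index_set k delta `|` index_set k epsilon ->
      exists2 L : R, 0 < L & forall x y,
      is_solution k alpha beta gamma A B C p delta epsilon q D E x y ->
      forall n : nat, (k < n)%N -> L <= x n%:Z.
    move=> qp sub.
    have [L L_gt0 y_geL] := affine_quotient_ge m M p q delta epsilon D E m01
      M_ge1 p_ge0 q_ge0 qp delta_ge0 epsilon_ge0 D_ge0 E_ge0 sub.
    exists (M1 * L); first exact: mulr_gt0.
    move=> x y sol n nk; have n_gt0 := leq_ltn_trans (leq0n k) nk.
    apply: le_trans (comparable x y sol n n_gt0).1; rewrite ler_pM2l //.
    have [_ den_neq0 _ ->] := sol.2 n n_gt0.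
    apply: y_geL; first by move=> i; apply: compare_prev.
    by rewrite lt_neqAle eq_sym den_neq0 form_ge0.
  case: cases => [[sub _]|[q0 sub _]|[p_gt0 _ sub _]]; last 2 first.
  - by apply: lower_y sub; rewrite q0 ltxx.
  - exact: lower_y sub.
  (* Case (i) bounds the quotient for [x] directly; [A = 0] makes the condition on the constants
     vacuous. *)
  have AA : 0 < A -> 0 < alpha by rewrite A_eq0 ltxx.
  have [L L_gt0 x_geL] := affine_quotient_ge m M alpha A beta gamma B C m01
    M_ge1 alpha_ge0 A_ge0 AA beta_ge0 gamma_ge0 B_ge0 C_ge0 sub.
  exists L => // x y sol n nk; have n_gt0 := leq_ltn_trans (leq0n k) nk.
  have [den_neq0 _ -> _] := sol.2 n n_gt0.
  apply: x_geL; first by move=> i; apply: compare_prev.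
  by rewrite lt_neqAle eq_sym den_neq0 form_ge0.
have BC_neq0 : index_set k B `|` index_set k C !=set0.
  by case: cases => [[_ [j Bj]]|[_ _ [j Cj]]|[_ _ _ [j Cj]]];
    exists j; [left | right | right].
have s_ge0 := nonneg_coeffs_scaleD _ _ _ (ltW M_gt0) beta_ge0 gamma_ge0.
have b_ge0 := nonneg_coeffs_scaleD _ _ _ (ltW m_gt0) B_ge0 C_ge0.
have [||Mx x_le] := eventually_bounded (eta := eta) alpha_ge0 L_gt0 s_ge0 b_ge0.
- by rewrite index_set_scaleD.
- by rewrite !index_set_scaleD.
(* The threshold adds to [eta.+1 * k] the shift [k.+1] used below; the factor [M] covers
   [y <= M * x]. *)
exists (M * (1 + `|Mx|)), (eta.+1 * k + k.+1)%N; split.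
- by rewrite mulr_gt0 // ltr_pwDl.
- by rewrite addnS.
move=> x y sol n n_gt.
have x_n : x n%:Z <= 1 + `|Mx|.
  apply: (@le_trans _ _ Mx); last by rewrite ler_wpDl // ler_norm.
  (* Shifting time by [k.+1] yields a sequence that is at least [L] from index [0] on. *)
  have {1}-> : n = ((n - k.+1) + k.+1)%N by clear -n_gt; lia.
  apply: (x_le (fun j => x (j + k.+1)%N%:Z)); last by clear -n_gt; lia.
    by move=> j; apply: x_geL sol _ _; rewrite addnS ltnS leq_addl.
  move=> j kj.
  have shift i : (1 <= i <= k)%N ->
      (j + k.+1)%N%:Z - i%:Z = (j - i + k.+1)%N%:Z by clear -kj; lia.
  have jk : (k < j + k.+1)%N by rewrite addnS ltnS leq_addl.
  have [//|den_neq0 _ x_eq _] := sol.2 (j + k.+1)%N; first by rewrite addnS.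
  have prev i ik := compare_prev x y _ i sol jk ik.
  have num_le := affine_form_le alpha beta gamma x y _ M M_ge1 beta_ge0
    gamma_ge0 (fun i ik => conj (prev i ik).1 (proj2 (andP (prev i ik).2))).
  have den_ge := affine_form_ge A B C x y _ m m_le1 B_ge0 C_ge0
    (fun i ik => conj (prev i ik).1 (proj1 (andP (prev i ik).2))).
  have sum_shift (a : nat -> R) : \sum_(1 <= i < k.+1) a i * x (j - i + k.+1)%N%:Z =
      \sum_(1 <= i < k.+1) a i * x ((j + k.+1)%N%:Z - i%:Z).
    by apply: eq_big_nat => i ik; rewrite shift.
  rewrite !sum_shift; apply: le_trans num_le.
  (* The numerator equals [x] times the denominator, and with [A = 0] the denominator is at least
     the merged sum alone. *)
  rewrite -[leRHS](divfK den_neq0) -x_eq ler_wpM2l //.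
    by apply: le_trans (x_geL _ _ sol _ jk); apply: ltW.
  by apply: le_trans den_ge; rewrite A_eq0 add0r.
have [|x_ge0 /andP[_ y_le]] := compare x y sol n%:Z; first by clear -n_gt; lia.
split; last by apply: le_trans y_le _; rewrite ler_pM2l.
by apply: le_trans x_n _; rewrite ler_peMl // addr_ge0.
Qed.
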